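(* Let $\alpha_1,\alpha_2,\alpha_3$, $\beta_1,\beta_2,\beta_3$ and $\gamma_1,\gamma_2,\gamma_3$ be real numbers, with not all $\alpha_j$, not all $\beta_j$ and not all $\gamma_j$ zero, such that $$\sum_{j=1}^3\alpha_j\beta_j=0,\quad \sum_{j=1}^3\alpha_j\gamma_j=0,\quad \sum_{j=1}^3\beta_j\gamma_j=0,\quad \sum_{j=1}^3\alpha_j\beta_j\gamma_j=0.$$ Let $I,J,K$ be open intervals in $\mathbb{R}$. Suppose that $x_1,x_2,x_3:I\to\mathbb{C}$ and $u:I\to\mathbb{R}$ are functions of $r$, that $y_1,y_2,y_3:J\to\mathbb{C}$ and $v:J\to\mathbb{R}$ are functions of $s$, and that $z_1,z_2,z_3:K\to\mathbb{C}$ and $w:K\to\mathbb{R}$ are functions of $t$, satisfying (i) $\frac{dx_1}{dr}=\alpha_1\overline{x_2x_3}$, $\frac{dx_2}{dr}=\alpha_2\overline{x_3x_1}$, $\frac{dx_3}{dr}=\alpha_3\overline{x_1x_2}$; (ii) $\frac{dy_1}{ds}=\beta_1\overline{y_2y_3}$, $\frac{dy_2}{ds}=\beta_2\overline{y_3y_1}$, $\frac{dy_3}{ds}=\beta_3\overline{y_1y_2}$; (iii) $\frac{dz_1}{dt}=\gamma_1\overline{z_2z_3}$, $\frac{dz_2}{dt}=\gamma_2\overline{z_3z_1}$, $\frac{dz_3}{dt}=\gamma_3\overline{z_1z_2}$; (iv) $|x_j|^2=\alpha_ju+1$, $|y_j|^2=\beta_jv+1$, $|z_j|^2=\gamma_jw+1$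 for $j=1,2,3$. If (i)–(iii) hold for all $r\in I$, $s\in J$, $t\in K$, and (iv) holds for some $r,s,t$ (for some real values of $u,v,w$ there), then (iv) holds for all $r,s,t$, for some functions $u,v,w$. Define $\Phi:I\times J\times K\to\mathbb{C}^3$ by $$\Phi(r,s,t)=\bigl(x_1(r)y_1(s)z_1(t),\,x_2(r)y_2(s)z_2(t),\,x_3(r)y_3(s)z_3(t)\bigr),$$ and let $N=\{\Phi(r,s,t):r\in I,\ s\in J,\ t\in K\}$. Then $N$ is a special Lagrangian $3$-fold in $\mathbb{C}^3$.
   Context: On $\mathbb{C}^3$ with coordinates $(z_1,z_2,z_3)$ let $g=\sum_j|dz_j|^2$, $\omega=\frac{i}{2}\sum_j dz_j\wedge d\bar z_j$ and $\Omega=dz_1\wedge dz_2\wedge dz_3$. An oriented real 3-dimensional submanifold $L$ of $\mathbb{C}^3$ is special Lagrangian if it is calibrated by $\operatorname{Re}\Omega$, i.e. $\operatorname{Re}\Omega|_{T_xL}=\mathrm{vol}_{T_xL}$ for all $x\in L$. A real 3-dimensional submanifold $L$ admits an orientation making it special Lagrangian if and only if $\omega|_L\equiv0$ and $\operatorname{Im}\Omega|_L\equiv 0$. The set $N$ may be singular; ''$N$ is a special Lagrangian 3-fold'' means that it is special Lagrangian wherever $\Phi$ is an immersion: at every $(r,s,t)$ where $\frac{\partial\Phi}{\partial r},\frac{\partial\Phi}{\partial s},\frac{\partial\Phi}{\partial t}$ are linearly independent over $\mathbb{R}$, their real span is a 3-plane on which $\omega$ and $\operatorname{Im}\Omega$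 vanish. *)

(* Defs.v *)
From Stdlib Require Export Reals.
From Coquelicot Require Export Coquelicot.
Open Scope R_scope.

Definition C3 : NormedModule R_AbsRing :=
  prod_NormedModule R_AbsRing
    (prod_NormedModule R_AbsRing C_R_NormedModule C_R_NormedModule)
    C_R_NormedModule.

Definition dz1 (X : C3) : C := fst (fst X).
Definition dz2 (X : C3) : C := snd (fst X).
Definition dz3 (X : C3) : C := snd X.
Definition dzbar1 (X : C3) : C := Cconj (dz1 X).
Definition dzbar2 (X : C3) : C := Cconj (dz2 X).
Definition dzbar3 (X : C3) : C := Cconj (dz3 X).

Definition wedge2 (a b : C3 -> C) (X Y : C3) : C :=
  (a X * b Y - a Y * b X)%C.

Definition wedge3 (a b c : C3 -> C) (X Y Z : C3) : C :=
  (a X * wedge2 b c Y Z + a Y * wedge2 b c Z X + a Z * wedge2 b c X Y)%C.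

(* Complex-valued a priori; it takes real values. *)
Definition omega (X Y : C3) : C :=
  (Ci / 2 * (wedge2 dz1 dzbar1 X Y + wedge2 dz2 dzbar2 X Y
             + wedge2 dz3 dzbar3 X Y))%C.

Definition Omega : C3 -> C3 -> C3 -> C := wedge3 dz1 dz2 dz3.

Definition lincomb3 (X Y Z : C3) (a b c : R) : C3 :=
  plus (plus (scal a X) (scal b Y)) (scal c Z).

Definition lin_indep3 (X Y Z : C3) : Prop :=
  forall a b c : R, lincomb3 X Y Z a b c = zero -> a = 0 /\ b = 0 /\ c = 0.

Definition real_span3 (X Y Z : C3) (V : C3) : Prop :=
  exists a b c : R, V = lincomb3 X Y Z a b c.

Definition real_3_plane (P : C3 -> Prop) : Prop :=
  exists X Y Z : C3, lin_indep3 X Y Z /\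
    forall V : C3, P V <-> real_span3 X Y Z V.

Definition special_Lagrangian_plane (P : C3 -> Prop) : Prop :=
  real_3_plane P /\
  (forall X Y : C3, P X -> P Y -> omega X Y = 0) /\
  (forall X Y Z : C3, P X -> P Y -> P Z -> Im (Omega X Y Z) = 0).

(* The possibly singular 3-fold parametrized by Phi on D1 x D2 x D3 is special
   Lagrangian wherever Phi is an immersion.  The partial derivatives are
   required to exist at every point of the domain, immersed or not. *)
Definition special_Lagrangian_image (D1 D2 D3 : R -> Prop)
    (Phi : R -> R -> R -> C3) : Prop :=
  forall r s t : R, D1 r -> D2 s -> D3 t ->
  exists Phi_r Phi_s Phi_t : C3,
    is_derive (fun r' : R => Phi r' s t) r Phi_r /\
    is_derive (fun s' : R => Phi r s' t) s Phi_s /\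
    is_derive (fun t' : R => Phi r s t') t Phi_t /\
    (lin_indep3 Phi_r Phi_s Phi_t ->
     special_Lagrangian_plane (real_span3 Phi_r Phi_s Phi_t)).

(* Infinite endpoints are allowed; empty when b <= a. *)
Definition Rbar_open_interval (a b : Rbar) (t : R) : Prop :=
  Rbar_lt a t /\ Rbar_lt t b.

(* The functions are total, but only their values on D are constrained: D is
   an open interval in use, so the derivative at a point of D only depends on
   values in D. *)
Definition ode_system (c1 c2 c3 : R) (D : R -> Prop) (f1 f2 f3 : R -> C)
    : Prop :=
  forall t : R, D t ->
    is_derive f1 t (c1 * Cconj (f2 t * f3 t))%C /\
    is_derive f2 t (c2 * Cconj (f3 t * f1 t))%C /\
    is_derive f3 t (c3 * Cconj (f1 t * f2 t))%C.

Definition moduli_eq (c1 c2 c3 : R) (p1 p2 p3 : C) (h : R) : Prop :=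
  Cmod p1 ^ 2 = c1 * h + 1 /\
  Cmod p2 ^ 2 = c2 * h + 1 /\
  Cmod p3 ^ 2 = c3 * h + 1.

(* Main.v *)
Require Import Defs.
From Stdlib Require Import Reals Lra.
From Coquelicot Require Import Coquelicot.
Open Scope R_scope.

(** Persistence of the moduli relations.  Along a solution of [p_j' = c_j * conj (p_k p_l)] one
    has [(|p_j|^2)' = 2 c_j Re (p_1 p_2 p_3)], with the same real factor for the
    three values of [j].  Hence the vector [(|p_j|^2 - 1)_j] moves parallel to
    the fixed vector [c], and if it is a multiple of [c] at one point of the
    interval, then it is one everywhere; the multiple is recovered by projecting
    on [c] ([moduli_eq_propagates]).

    Special Lagrangian condition.  Both forms are multilinear, so it suffices to
    evaluate them on the partial derivatives ([omega_lincomb3],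
    [Omega_lincomb3]).  For two distinct parameters, say [r] and [s],
    [omega (Phi_r, Phi_s)] is minus the imaginary part of
    [conj (x_1 x_2 x_3) y_1 y_2 y_3 * sum_j al_j be_j |z_j|^2]
    and by the moduli relation the sum is [w * sum_j al_j be_j ga_j + sum_j al_j be_j = 0]
    ([omega_partials]).  The six terms of [Omega (Phi_r, Phi_s, Phi_t)] are real
    multiples of products of squared moduli, such as
    [al_1 be_2 ga_3 |x_2|^2 |x_3|^2 |y_1|^2 |y_3|^2 |z_1|^2 |z_2|^2],
    so [Omega] is real on the tangent space ([Im_Omega_partials]). *)

(** * Derivatives of complex-valued functions of a real variable *)

Lemma scal_C_R (a : R) (z : C) :
  @scal R_AbsRing C_R_NormedModule a z = (a * z)%C.
Proof.
  destruct z as [p q]; apply injective_projections; cbn; ring.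
Qed.

Lemma norm_C_R (z : C) : @norm R_AbsRing C_R_NormedModule z = Cmod z.
Proof.
  unfold norm; simpl; unfold prod_norm, Cmod; f_equal.
  change (Rabs (fst z) ^ 2 + Rabs (snd z) ^ 2 = fst z ^ 2 + snd z ^ 2).
  now rewrite !pow2_abs.
Qed.

Lemma is_linear_Cmult_r (c : C) :
  @is_linear R_AbsRing C_R_NormedModule C_R_NormedModule
    (fun z : C => (z * c)%C).
Proof.
  apply Build_is_linear.
  - intros x y. exact (Cmult_plus_distr_r x y c).
  - intros k x. rewrite !scal_C_R. symmetry. apply Cmult_assoc.
  - exists (Cmod c + 1). split.
    + generalize (Cmod_ge_0 c); lra.
    + intros x. rewrite !norm_C_R, Cmod_mult.
      generalize (Cmod_ge_0 c) (Cmod_ge_0 x); nra.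
Qed.

Lemma is_derive_linear {U V : NormedModule R_AbsRing} (l : U -> V)
    (f : R -> U) (t : R) (d : U) :
  is_linear l -> is_derive f t d -> is_derive (fun t' => l (f t')) t (l d).
Proof.
  intros Hl Hf. unfold is_derive.
  apply (filterdiff_ext_lin _ (fun y : R => l (scal y d))).
  - exact (filterdiff_comp f l _ l Hf (filterdiff_linear l Hl)).
  - intros y. apply (linear_scal l Hl).
Qed.

Lemma is_derive_eq (f : R -> R) (t d d' : R) :
  is_derive f t d -> d = d' -> is_derive f t d'.
Proof. now intros Hf <-. Qed.

Lemma is_derive_pair {U V : NormedModule R_AbsRing}
    (f : R -> U) (g : R -> V) (t : R) (df : U) (dg : V) :
  is_derive f t df -> is_derive g t dg ->
  @is_derive R_AbsRing (prod_NormedModule R_AbsRing U V)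
    (fun t' => (f t', g t')) t (df, dg).
Proof.
  intros Hf Hg.
  refine (filterdiff_comp'_2 (W := prod_NormedModule R_AbsRing U V)
    f g (fun a b => (a, b)) t _ _ (fun a b => (a, b)) Hf Hg _).
  apply (filterdiff_linear
    (V := prod_NormedModule R_AbsRing U V)).
  apply is_linear_prod; [apply is_linear_fst | apply is_linear_snd].
Qed.

Lemma is_derive_C3_Cmult_r (f1 f2 f3 : R -> C) (t : R) (d1 d2 d3 c1 c2 c3 : C) :
  is_derive f1 t d1 -> is_derive f2 t d2 -> is_derive f3 t d3 ->
  @is_derive R_AbsRing C3
    (fun t' => ((f1 t' * c1)%C, (f2 t' * c2)%C, (f3 t' * c3)%C)) t
    ((d1 * c1)%C, (d2 * c2)%C, (d3 * c3)%C).
Proof.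
  intros H1 H2 H3.
  apply (is_derive_pair (U := prod_NormedModule R_AbsRing C_R_NormedModule
    C_R_NormedModule) (V := C_R_NormedModule));
    [apply (is_derive_pair (U := C_R_NormedModule) (V := C_R_NormedModule))|].
  - exact (is_derive_linear (U := C_R_NormedModule) _ f1 t d1
      (is_linear_Cmult_r c1) H1).
  - exact (is_derive_linear (U := C_R_NormedModule) _ f2 t d2
      (is_linear_Cmult_r c2) H2).
  - exact (is_derive_linear (U := C_R_NormedModule) _ f3 t d3
      (is_linear_Cmult_r c3) H3).
Qed.

Lemma Cmod_sq (z : C) : Cmod z ^ 2 = Re z ^ 2 + Im z ^ 2.
Proof.
  unfold Cmod. rewrite pow2_sqrt; [reflexivity|]. nra.
Qed.

Lemma Cmod_sq_C (z : C) : RtoC (Cmod z ^ 2) = (z * Cconj z)%C.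
Proof.
  rewrite Cmod_sq. destruct z as [a b].
  apply injective_projections; simpl; ring.
Qed.

Lemma is_derive_Cmod_sq (f : R -> C) (t : R) (d : C) :
  is_derive f t d ->
  is_derive (fun t' => Cmod (f t') ^ 2) t (2 * Re (Cconj (f t) * d)%C).
Proof.
  intros Hf.
  assert (H1 : is_derive (fun t' => Re (f t')) t (Re d)).
  { refine (is_derive_linear (U := C_R_NormedModule) (V := R_NormedModule)
      (fun z : C => Re z) f t d _ Hf). apply is_linear_fst. }
  assert (H2 : is_derive (fun t' => Im (f t')) t (Im d)).
  { refine (is_derive_linear (U := C_R_NormedModule) (V := R_NormedModule)
      (fun z : C => Im z) f t d _ Hf). apply is_linear_snd. }
  apply (is_derive_ext (fun t' => Re (f t') ^ 2 + Im (f t') ^ 2)).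
  - intros t'. now rewrite Cmod_sq.
  - apply (is_derive_eq _ _ _ _ (is_derive_plus _ _ _ _ _
      (is_derive_pow _ 2 _ _ H1) (is_derive_pow _ 2 _ _ H2))).
    unfold Re, Im; cbn; ring.
Qed.

(** * Conservation of the moduli relations *)

Lemma Rbar_open_interval_convex (a b : Rbar) (p q t : R) :
  Rbar_open_interval a b p -> Rbar_open_interval a b q -> p <= t <= q ->
  Rbar_open_interval a b t.
Proof.
  intros [Hp _] [_ Hq] [H1 H2]. split.
  - exact (Rbar_lt_le_trans a p t Hp H1).
  - exact (Rbar_le_lt_trans t q b H2 Hq).
Qed.

Lemma is_derive_zero_constant (a b : Rbar) (f : R -> R) (p q : R) :
  (forall t, Rbar_open_interval a b t -> is_derive f t 0) ->
  Rbar_open_interval a b p -> Rbar_open_interval a b q -> f p = f q.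
Proof.
  intros Hf Hp Hq.
  destruct (Rtotal_order p q) as [Hpq | [-> | Hqp]].
  - apply (eq_is_derive f p q); [|exact Hpq].
    intros t Ht. exact (Hf t (Rbar_open_interval_convex a b p q t Hp Hq Ht)).
  - reflexivity.
  - symmetry. apply (eq_is_derive f q p); [|exact Hqp].
    intros t Ht. exact (Hf t (Rbar_open_interval_convex a b q p t Hq Hp Ht)).
Qed.

Lemma ode_system_derive_Cmod_sq (c1 c2 c3 : R) (D : R -> Prop)
    (f1 f2 f3 : R -> C) (t : R) :
  ode_system c1 c2 c3 D f1 f2 f3 -> D t ->
  let rho := 2 * Re (f1 t * f2 t * f3 t)%C in
  is_derive (fun t' => Cmod (f1 t') ^ 2) t (c1 * rho) /\
  is_derive (fun t' => Cmod (f2 t') ^ 2) t (c2 * rho) /\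
  is_derive (fun t' => Cmod (f3 t') ^ 2) t (c3 * rho).
Proof.
  intros Hode Ht rho. destruct (Hode t Ht) as (H1 & H2 & H3).
  split; [|split].
  - apply (is_derive_eq _ _ _ _ (is_derive_Cmod_sq _ _ _ H1)). 
    unfold rho; simpl; ring.
  - apply (is_derive_eq _ _ _ _ (is_derive_Cmod_sq _ _ _ H2)). 
    unfold rho; simpl; ring.
  - apply (is_derive_eq _ _ _ _ (is_derive_Cmod_sq _ _ _ H3)). 
    unfold rho; simpl; ring.
Qed.

(** The coefficient of the projection of [(|p_j|^2 - 1)_j] on the vector [c];
    if [c <> 0], it is the only candidate for the parameter in [moduli_eq]. *)
Definition moduli_param (c1 c2 c3 : R) (p1 p2 p3 : C) : R :=
  (c1 * (Cmod p1 ^ 2 - 1) + c2 * (Cmod p2 ^ 2 - 1) + c3 * (Cmod p3 ^ 2 - 1))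
  / (c1 ^ 2 + c2 ^ 2 + c3 ^ 2).

Lemma moduli_eq_param (c1 c2 c3 : R) (p1 p2 p3 : C) (h : R) :
  ~ (c1 = 0 /\ c2 = 0 /\ c3 = 0) ->
  moduli_eq c1 c2 c3 p1 p2 p3 h -> moduli_param c1 c2 c3 p1 p2 p3 = h.
Proof.
  intros Hc (H1 & H2 & H3). unfold moduli_param. rewrite H1, H2, H3. field.
  intros H0. apply Hc. repeat split; nra.
Qed.

Lemma is_derive_weighted_sum3 (c1 c2 c3 n : R) (m1 m2 m3 : R -> R)
    (t d1 d2 d3 : R) :
  is_derive m1 t d1 -> is_derive m2 t d2 -> is_derive m3 t d3 ->
  is_derive
    (fun t' => (c1 * (m1 t' - 1) + c2 * (m2 t' - 1) + c3 * (m3 t' - 1)) / n) t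
    ((c1 * d1 + c2 * d2 + c3 * d3) / n).
Proof.
  intros D1 D2 D3. auto_derive.
  - repeat split; eexists; eassumption.
  - rewrite (is_derive_unique _ t _ D1 : Derive (fun x : R => m1 x) t = d1),
      (is_derive_unique _ t _ D2 : Derive (fun x : R => m2 x) t = d2),
      (is_derive_unique _ t _ D3 : Derive (fun x : R => m3 x) t = d3).
    unfold Rdiv; ring.
Qed.

Lemma moduli_eq_propagates (c1 c2 c3 : R) (a b : Rbar) (f1 f2 f3 : R -> C)
    (t0 h0 : R) :
  ~ (c1 = 0 /\ c2 = 0 /\ c3 = 0) ->
  ode_system c1 c2 c3 (Rbar_open_interval a b) f1 f2 f3 ->
  Rbar_open_interval a b t0 ->
  moduli_eq c1 c2 c3 (f1 t0) (f2 t0) (f3 t0) h0 ->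
  forall t, Rbar_open_interval a b t ->
    moduli_eq c1 c2 c3 (f1 t) (f2 t) (f3 t)
      (moduli_param c1 c2 c3 (f1 t) (f2 t) (f3 t)).
Proof.
  intros Hc Hode Ht0 H0 t Ht.
  assert (Hn : c1 ^ 2 + c2 ^ 2 + c3 ^ 2 <> 0).
  { intros Hn. apply Hc. repeat split; nra. }
  pose (h := fun t' => moduli_param c1 c2 c3 (f1 t') (f2 t') (f3 t')).
  assert (Hh0 : h t0 = h0) by (apply moduli_eq_param; assumption).
  assert (Hh : forall t', Rbar_open_interval a b t' ->
    is_derive h t' (2 * Re (f1 t' * f2 t' * f3 t')%C)).
  { intros t' Ht'.
    destruct (ode_system_derive_Cmod_sq _ _ _ _ _ _ _ t' Hode Ht')
      as (D1 & D2 & D3).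
    set (rho := 2 * Re _) in *.
    apply (is_derive_eq _ _ _ _
      (is_derive_weighted_sum3 c1 c2 c3 (c1 ^ 2 + c2 ^ 2 + c3 ^ 2)
         _ _ _ t' _ _ _ D1 D2 D3)).
    field. exact Hn. }
  (* [|f_j|^2 - c_j h] is a constant of motion *)
  assert (Hdefect : forall c (f : R -> C),
    (forall t', Rbar_open_interval a b t' ->
      is_derive (fun x => Cmod (f x) ^ 2) t'
        (c * (2 * Re (f1 t' * f2 t' * f3 t')%C))) ->
    Cmod (f t0) ^ 2 = c * h0 + 1 -> Cmod (f t) ^ 2 = c * h t + 1).
  { intros c f Hf Hf0.
    assert (E : (fun x => Cmod (f x) ^ 2 - c * h x) t
                = (fun x => Cmod (f x) ^ 2 - c * h x) t0).
    { apply (is_derive_zero_constant a b (fun x => Cmod (f x) ^ 2 - c * h x));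
        [|assumption..].
      intros t' Ht'.
      apply (is_derive_eq _ _ _ _ (is_derive_minus _ _ _ _ _ (Hf t' Ht')
        (is_derive_scal h t' c _ (Hh t' Ht')))).
      cbn; ring. }
    cbv beta in E. rewrite Hh0 in E. lra. }
  destruct H0 as (E1 & E2 & E3).
  split; [|split]; apply Hdefect; try assumption; intros t' Ht';
    apply (ode_system_derive_Cmod_sq _ _ _ _ _ _ _ t' Hode Ht').
Qed.

(** * The forms on a real span *)

Lemma dz_lincomb3 (X Y Z : C3) (a b c : R) :
  dz1 (lincomb3 X Y Z a b c) = (a * dz1 X + b * dz1 Y + c * dz1 Z)%C /\
  dz2 (lincomb3 X Y Z a b c) = (a * dz2 X + b * dz2 Y + c * dz2 Z)%C /\
  dz3 (lincomb3 X Y Z a b c) = (a * dz3 X + b * dz3 Y + c * dz3 Z)%C.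
Proof.
  rewrite <- !scal_C_R. repeat split; reflexivity.
Qed.

Lemma Cconj_RtoC (a : R) : Cconj a = a.
Proof. apply injective_projections; simpl; ring. Qed.

Lemma dzbar_lincomb3 (X Y Z : C3) (a b c : R) :
  dzbar1 (lincomb3 X Y Z a b c) = (a * dzbar1 X + b * dzbar1 Y + c * dzbar1 Z)%C /\
  dzbar2 (lincomb3 X Y Z a b c) = (a * dzbar2 X + b * dzbar2 Y + c * dzbar2 Z)%C /\
  dzbar3 (lincomb3 X Y Z a b c) = (a * dzbar3 X + b * dzbar3 Y + c * dzbar3 Z)%C.
Proof.
  unfold dzbar1, dzbar2, dzbar3.
  destruct (dz_lincomb3 X Y Z a b c) as (-> & -> & ->).
  rewrite !Cplus_conj, !Cmult_conj, !Cconj_RtoC. repeat split; reflexivity.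
Qed.

Lemma omega_lincomb3 (X Y Z : C3) (a b c a' b' c' : R) :
  omega (lincomb3 X Y Z a b c) (lincomb3 X Y Z a' b' c')
  = ((a * b' - b * a') * omega X Y + (b * c' - c * b') * omega Y Z
     + (c * a' - a * c') * omega Z X)%C.
Proof.
  unfold omega, wedge2.
  destruct (dz_lincomb3 X Y Z a b c) as (-> & -> & ->).
  destruct (dz_lincomb3 X Y Z a' b' c') as (-> & -> & ->).
  destruct (dzbar_lincomb3 X Y Z a b c) as (-> & -> & ->).
  destruct (dzbar_lincomb3 X Y Z a' b' c') as (-> & -> & ->).
  unfold Cdiv. ring.
Qed.

Lemma omega_antisym (X Y : C3) : omega X Y = (- omega Y X)%C.
Proof. unfold omega, wedge2, Cdiv. ring. Qed.

(** The coefficient is the determinant of the three coordinate vectors. *)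
Lemma Omega_lincomb3 (X Y Z : C3) (a b c a' b' c' a'' b'' c'' : R) :
  Omega (lincomb3 X Y Z a b c) (lincomb3 X Y Z a' b' c')
    (lincomb3 X Y Z a'' b'' c'')
  = (RtoC (a * (b' * c'' - c' * b'') + b * (c' * a'' - a' * c'')
           + c * (a' * b'' - b' * a'')) * Omega X Y Z)%C.
Proof.
  unfold Omega, wedge3, wedge2.
  destruct (dz_lincomb3 X Y Z a b c) as (-> & -> & ->).
  destruct (dz_lincomb3 X Y Z a' b' c') as (-> & -> & ->).
  destruct (dz_lincomb3 X Y Z a'' b'' c'') as (-> & -> & ->).
  rewrite !RtoC_plus, !RtoC_mult, !RtoC_minus, !RtoC_mult. ring.
Qed.

Lemma special_Lagrangian_plane_real_span3 (X Y Z : C3) :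
  omega X Y = 0 -> omega Y Z = 0 -> omega Z X = 0 -> Im (Omega X Y Z) = 0 ->
  lin_indep3 X Y Z -> special_Lagrangian_plane (real_span3 X Y Z).
Proof.
  intros HXY HYZ HZX HO Hind. split; [|split].
  - exists X, Y, Z. split; [exact Hind | reflexivity].
  - intros U V (a & b & c & ->) (a' & b' & c' & ->).
    rewrite omega_lincomb3, HXY, HYZ, HZX. ring.
  - intros U V W (a & b & c & ->) (a' & b' & c' & ->) (a'' & b'' & c'' & ->).
    rewrite Omega_lincomb3.
    simpl in HO |- *. rewrite HO. ring.
Qed.

(** * The tangent vectors of the parametrization *)

(** [partial c p q m] is the derivative of [(p_j q_j m_j)_j] in the parameter of
    [p], when [p] solves the system with coefficients [c].  Each of the three
    partial derivatives of the parametrization is of this form, with the roles of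
    the three triples permuted. *)
Definition partial (c1 c2 c3 : R) (p1 p2 p3 q1 q2 q3 m1 m2 m3 : C) : C3 :=
  ((c1 * Cconj (p2 * p3) * (q1 * m1))%C,
   (c2 * Cconj (p3 * p1) * (q2 * m2))%C,
   (c3 * Cconj (p1 * p2) * (q3 * m3))%C).

Lemma is_derive_partial (c1 c2 c3 : R) (D : R -> Prop) (f1 f2 f3 : R -> C)
    (t : R) (q1 q2 q3 m1 m2 m3 : C) :
  ode_system c1 c2 c3 D f1 f2 f3 -> D t ->
  @is_derive R_AbsRing C3
    (fun t' => ((f1 t' * (q1 * m1))%C, (f2 t' * (q2 * m2))%C,
                (f3 t' * (q3 * m3))%C)) t
    (partial c1 c2 c3 (f1 t) (f2 t) (f3 t) q1 q2 q3 m1 m2 m3).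
Proof.
  intros Hode Ht. destruct (Hode t Ht) as (H1 & H2 & H3).
  now apply is_derive_C3_Cmult_r.
Qed.

Lemma partial_swap (c1 c2 c3 : R) (p1 p2 p3 q1 q2 q3 m1 m2 m3 : C) :
  partial c1 c2 c3 p1 p2 p3 q1 q2 q3 m1 m2 m3
  = partial c1 c2 c3 p1 p2 p3 m1 m2 m3 q1 q2 q3.
Proof.
  unfold partial.
  now rewrite (Cmult_comm q1), (Cmult_comm q2), (Cmult_comm q3).
Qed.

Lemma omega_partials (a1 a2 a3 b1 b2 b3 c1 c2 c3 h : R)
    (p1 p2 p3 q1 q2 q3 m1 m2 m3 : C) :
  a1 * b1 + a2 * b2 + a3 * b3 = 0 ->
  a1 * b1 * c1 + a2 * b2 * c2 + a3 * b3 * c3 = 0 ->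
  moduli_eq c1 c2 c3 m1 m2 m3 h ->
  omega (partial a1 a2 a3 p1 p2 p3 q1 q2 q3 m1 m2 m3)
        (partial b1 b2 b3 q1 q2 q3 p1 p2 p3 m1 m2 m3) = 0.
Proof.
  intros Hab Habc (H1 & H2 & H3).
  assert (Hsum : (a1 * b1 * (m1 * Cconj m1) + a2 * b2 * (m2 * Cconj m2)
                  + a3 * b3 * (m3 * Cconj m3) = 0)%C).
  { rewrite <- !Cmod_sq_C, H1, H2, H3, <- !RtoC_mult, <- !RtoC_plus.
    f_equal.
    transitivity ((a1 * b1 * c1 + a2 * b2 * c2 + a3 * b3 * c3) * h
                  + (a1 * b1 + a2 * b2 + a3 * b3)); [ring|].
    rewrite Hab, Habc. ring. }
  unfold omega, wedge2, dzbar1, dzbar2, dzbar3, dz1, dz2, dz3, partial.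
  simpl fst; simpl snd.
  rewrite !Cmult_conj, !Cconj_conj, !Cconj_RtoC.
  transitivity (Ci / 2 *
    ((Cconj (p1 * p2 * p3) * (q1 * q2 * q3)
      - (p1 * p2 * p3) * Cconj (q1 * q2 * q3))
     * (a1 * b1 * (m1 * Cconj m1) + a2 * b2 * (m2 * Cconj m2)
        + a3 * b3 * (m3 * Cconj m3))))%C.
  - rewrite !Cmult_conj. unfold Cdiv. ring.
  - rewrite Hsum. ring.
Qed.

Lemma Im_Omega_partials (a1 a2 a3 b1 b2 b3 c1 c2 c3 : R)
    (p1 p2 p3 q1 q2 q3 m1 m2 m3 : C) :
  Im (Omega (partial a1 a2 a3 p1 p2 p3 q1 q2 q3 m1 m2 m3)
            (partial b1 b2 b3 q1 q2 q3 p1 p2 p3 m1 m2 m3)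
            (partial c1 c2 c3 m1 m2 m3 p1 p2 p3 q1 q2 q3)) = 0.
Proof.
  pose (A := fun z : C => Cmod z ^ 2).
  (* in each term of the determinant, every variable that occurs is paired with
     its conjugate *)
  enough (E : Omega (partial a1 a2 a3 p1 p2 p3 q1 q2 q3 m1 m2 m3)
            (partial b1 b2 b3 q1 q2 q3 p1 p2 p3 m1 m2 m3)
            (partial c1 c2 c3 m1 m2 m3 p1 p2 p3 q1 q2 q3)
    = RtoC (
        a1 * b2 * c3 * (A p2 * A p3 * A q1 * A q3 * A m1 * A m2)
      - a1 * c2 * b3 * (A p2 * A p3 * A q1 * A q2 * A m1 * A m3)
      + b1 * c2 * a3 * (A p1 * A p2 * A q2 * A q3 * A m1 * A m3)
      - b1 * a2 * c3 * (A p1 * A p3 * A q2 * A q3 * A m1 * A m2)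
      + c1 * a2 * b3 * (A p1 * A p3 * A q1 * A q2 * A m2 * A m3)
      - c1 * b2 * a3 * (A p1 * A p2 * A q1 * A q3 * A m2 * A m3)))
    by (rewrite E; reflexivity).
  repeat (rewrite ?RtoC_plus, ?RtoC_minus, ?RtoC_mult).
  unfold A. rewrite !Cmod_sq_C.
  unfold Omega, wedge3, wedge2, dz1, dz2, dz3, partial.
  simpl fst; simpl snd.
  rewrite !Cmult_conj. ring.
Qed.

Theorem theorem7p1
  (al1 al2 al3 be1 be2 be3 ga1 ga2 ga3 : R)
  (Hal : ~ (al1 = 0 /\ al2 = 0 /\ al3 = 0))
  (Hbe : ~ (be1 = 0 /\ be2 = 0 /\ be3 = 0))
  (Hga : ~ (ga1 = 0 /\ ga2 = 0 /\ ga3 = 0))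
  (Halbe : al1 * be1 + al2 * be2 + al3 * be3 = 0)
  (Halga : al1 * ga1 + al2 * ga2 + al3 * ga3 = 0)
  (Hbega : be1 * ga1 + be2 * ga2 + be3 * ga3 = 0)
  (Halbega : al1 * be1 * ga1 + al2 * be2 * ga2 + al3 * be3 * ga3 = 0)
  (aI bI aJ bJ aK bK : Rbar)
  (x1 x2 x3 y1 y2 y3 z1 z2 z3 : R -> C)
  (Hi : ode_system al1 al2 al3 (Rbar_open_interval aI bI) x1 x2 x3)
  (Hii : ode_system be1 be2 be3 (Rbar_open_interval aJ bJ) y1 y2 y3)
  (Hiii : ode_system ga1 ga2 ga3 (Rbar_open_interval aK bK) z1 z2 z3) :
  ((exists r s t : R,
      Rbar_open_interval aI bI r /\ Rbar_open_interval aJ bJ s /\ Rbar_open_interval aK bK t /\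
      exists u0 v0 w0 : R,
        moduli_eq al1 al2 al3 (x1 r) (x2 r) (x3 r) u0 /\
        moduli_eq be1 be2 be3 (y1 s) (y2 s) (y3 s) v0 /\
        moduli_eq ga1 ga2 ga3 (z1 t) (z2 t) (z3 t) w0) ->
   exists u v w : R -> R,
     forall r s t : R,
       Rbar_open_interval aI bI r -> Rbar_open_interval aJ bJ s -> Rbar_open_interval aK bK t ->
       moduli_eq al1 al2 al3 (x1 r) (x2 r) (x3 r) (u r) /\
       moduli_eq be1 be2 be3 (y1 s) (y2 s) (y3 s) (v s) /\
       moduli_eq ga1 ga2 ga3 (z1 t) (z2 t) (z3 t) (w t))
  /\
  (forall u v w : R -> R,
     (forall r s t : R,
       Rbar_open_interval aI bI r -> Rbar_open_interval aJ bJ s -> Rbar_open_interval aK bK t ->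
       moduli_eq al1 al2 al3 (x1 r) (x2 r) (x3 r) (u r) /\
       moduli_eq be1 be2 be3 (y1 s) (y2 s) (y3 s) (v s) /\
       moduli_eq ga1 ga2 ga3 (z1 t) (z2 t) (z3 t) (w t)) ->
   special_Lagrangian_image
     (Rbar_open_interval aI bI) (Rbar_open_interval aJ bJ) (Rbar_open_interval aK bK)
     (fun r s t : R =>
        ((x1 r * y1 s * z1 t)%C, (x2 r * y2 s * z2 t)%C, (x3 r * y3 s * z3 t)%C))).
Proof.
  split.
  - intros (r0 & s0 & t0 & Hr0 & Hs0 & Ht0 & u0 & v0 & w0 & Hu & Hv & Hw).
    exists (fun r => moduli_param al1 al2 al3 (x1 r) (x2 r) (x3 r)),
      (fun s => moduli_param be1 be2 be3 (y1 s) (y2 s) (y3 s)),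
      (fun t => moduli_param ga1 ga2 ga3 (z1 t) (z2 t) (z3 t)).
    intros r s t Hr Hs Ht. split; [|split].
    + exact (moduli_eq_propagates _ _ _ _ _ _ _ _ _ _ Hal Hi Hr0 Hu r Hr).
    + exact (moduli_eq_propagates _ _ _ _ _ _ _ _ _ _ Hbe Hii Hs0 Hv s Hs).
    + exact (moduli_eq_propagates _ _ _ _ _ _ _ _ _ _ Hga Hiii Ht0 Hw t Ht).
  - intros u v w Hm r s t Hr Hs Ht.
    destruct (Hm r s t Hr Hs Ht) as (Hu & Hv & Hw).
    exists (partial al1 al2 al3 (x1 r) (x2 r) (x3 r)
              (y1 s) (y2 s) (y3 s) (z1 t) (z2 t) (z3 t)),
      (partial be1 be2 be3 (y1 s) (y2 s) (y3 s)
              (x1 r) (x2 r) (x3 r) (z1 t) (z2 t) (z3 t)),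
      (partial ga1 ga2 ga3 (z1 t) (z2 t) (z3 t)
              (x1 r) (x2 r) (x3 r) (y1 s) (y2 s) (y3 s)).
    split; [|split; [|split]].
    + eapply is_derive_ext; [|exact (is_derive_partial _ _ _ _ _ _ _ _
        (y1 s) (y2 s) (y3 s) (z1 t) (z2 t) (z3 t) Hi Hr)].
      intros r'. cbv beta. now rewrite !Cmult_assoc.
    + eapply is_derive_ext; [|exact (is_derive_partial _ _ _ _ _ _ _ _
        (x1 r) (x2 r) (x3 r) (z1 t) (z2 t) (z3 t) Hii Hs)].
      intros s'. cbv beta.
      rewrite !Cmult_assoc.
      now rewrite (Cmult_comm (x1 r)), (Cmult_comm (x2 r)), (Cmult_comm (x3 r)).
    + eapply is_derive_ext; [|exact (is_derive_partial _ _ _ _ _ _ _ _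
        (x1 r) (x2 r) (x3 r) (y1 s) (y2 s) (y3 s) Hiii Ht)].
      intros t'. cbv beta.
      now rewrite (Cmult_comm (z1 t')), (Cmult_comm (z2 t')), (Cmult_comm (z3 t')).
    + apply special_Lagrangian_plane_real_span3.
      * now apply (omega_partials _ _ _ _ _ _ ga1 ga2 ga3 (w t)).
      * rewrite (partial_swap be1), (partial_swap ga1).
        apply (omega_partials _ _ _ _ _ _ al1 al2 al3 (u r));
          [assumption | lra | assumption].
      * rewrite omega_antisym, (partial_swap al1).
        rewrite (omega_partials _ _ _ _ _ _ be1 be2 be3 (v s));
          [ring | assumption | lra | assumption].
      * apply Im_Omega_partials.
Qed.
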